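(* Let $c_0,c_1\ge0$ with $c_0^2+c_1^2=1$, put $a=c_0^2$, and consider the qubit–qutrit state $|\psi\rangle=c_0|0\rangle_A|0\rangle_B+c_1|1\rangle_A|1\rangle_B$ in $\mathbb C^2\otimes\mathbb C^3$, so that $\rho_B=\operatorname{diag}(a,1-a,0)$. Let $A_1=\sigma_z$ on Alice's qubit (with $A_1=+1$ on $|0\rangle$). On Bob's qutrit let $P_j=|v_j\rangle\langle v_j|$, $j\in\mathbb Z/5$, with $$|v_j\rangle=\cos\theta|0\rangle+\sin\theta\cos\tfrac{4\pi j}{5}|1\rangle+\sin\theta\sin\tfrac{4\pi j}{5}|2\rangle,\qquad \cos\theta,\sin\theta>0,\quad\cos^2\theta=\tfrac{1}{\sqrt5},$$ and let $B_j=I-2P_j$, $D=\sum_{j\in\mathbb Z/5}B_jB_{j+1}$. Put $a_{\rm KCBS}=\tfrac12+\tfrac{\sqrt5}{10}$. Then: (i) the unconditional KCBS value is $\langle D\rangle_{\rm uncond}:=\operatorname{Tr}(\rho_BD)=a(5-4\sqrt5)+(1-a)(2\sqrt5-5)$; (ii) if $a\le a_{\rm KCBS}$, Bob's unconditional empirical model for the five contexts $\{B_j,B_{j+1}\}$, $j\in\mathbb Z/5$, is noncontextual, whereas if $a>a_{\rm KCBS}$ it violates the KCBS bound, i.e. $\langle D\rangle_{\rm uncond}<-3$; (iii) for every $a>0$, conditionally on the outcome $A_1=+1$ Bob's KCBS value is $\langle D\rangle_{A_1=+1}=5-4\sqrt5<-3$; (iv) the quantity $W=3\langle A_1\rangle+\langle(1+A_1)\otimes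 D\rangle$ equals $-3-8(\sqrt5-2)a$, so that $W<-3$ for every $a>0$. In particular, for every $0<a\le a_{\rm KCBS}$ Bob's unconditional KCBS statistics are noncontextual while his statistics conditioned on $A_1=+1$ violate the KCBS noncontextual bound $\langle D\rangle\ge-3$.
   Context: The observables $B_j$ take values $\pm1$; since $P_jP_{j+1}=0$, $B_j$ and $B_{j+1}$ commute and can be jointly measured, with joint distribution $p_j(b,b')$ given by the Born rule in Bob's state. Bob's empirical model for the five contexts is noncontextual if there exist a hidden variable $\lambda$ with a single probability distribution $q(\lambda)$ and, for each $j\in\mathbb Z/5$, response distributions $p(\cdot|j,\lambda)$ on $\{\pm1\}$ (not depending on the context) such that $p_j(b,b')=\sum_\lambda q(\lambda)\,p(b|j,\lambda)\,p(b'|j+1,\lambda)$ for all $j\in\mathbb Z/5$ and $b,b'\in\{\pm1\}$. Expectations $\langle\cdot\rangle$ without subscript are in the state $|\psi\rangle$; the subscript $A_1=+1$ denotes expectation in Bob's normalized post-measurement state given that outcome. Every noncontextual model satisfies the KCBS bound $\langle D\rangle\ge -3$. *)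

(* Defs.v *)
From HB Require Import structures.
From mathcomp Require Import all_boot all_order all_algebra.
From mathcomp Require Import complex mxtens.
From mathcomp Require Import reals trigo.

Set Implicit Arguments.
Unset Strict Implicit.
Unset Printing Implicit Defensive.

Import Order.TTheory GRing.Theory Num.Theory.
Local Open Scope ring_scope.
Local Open Scope complex_scope.
Local Open Scope sesquilinear_scope.

Definition ket {R : realType} {n} (i : 'I_n) : 'cV[R[i]]_n := delta_mx i 0.

Definition ketbra {R : realType} {n} (v : 'cV[R[i]]_n) : 'M[R[i]]_n :=
  v *m (v ^t* ).

Definition expect {R : realType} {n} (rho X : 'M[R[i]]_n) : R[i] :=
  \tr (rho *m X).

(* Partial trace over the first tensor factor. *)
Definition ptrace1 {R : realType} {m n} (X : 'M[R[i]]_(m * n)) : 'M[R[i]]_n :=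
  \matrix_(i, j) \sum_(k < m) X (mxtens_index (k, i)) (mxtens_index (k, j)).

(* Outcomes +1 and -1 are encoded by false and true. *)
Definition outcome {R : realType} (b : bool) : R[i] := (-1) ^+ b.

(* Spectral projection for the value outcome b of an observable X with
   X *m X = 1%:M. *)
Definition outcome_proj {R : realType} {n} (X : 'M[R[i]]_n) (b : bool) :
    'M[R[i]]_n :=
  2^-1 *: (1%:M + outcome b *: X).

(* Joint outcome probabilities, by the Born rule, of two commuting observables
   X and Y of square 1. *)
Definition joint_prob {R : realType} {n} (rho X Y : 'M[R[i]]_n)
    (b b' : bool) : R[i] :=
  expect rho (outcome_proj X b *m outcome_proj Y b').

(* Normalized state of the second factor after the observable A has been
   measured on the first factor of a system in state rho, with value
   outcome b. *)
Definition post_state {R : realType} {m n} (rho : 'M[R[i]]_(m * n))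
    (A : 'M[R[i]]_m) (b : bool) : 'M[R[i]]_n :=
  let E := outcome_proj A b *t (1%:M : 'M[R[i]]_n) in
  let sigma := E *m rho *m E in
  (\tr sigma)^-1 *: ptrace1 sigma.

Definition is_distr {R : realType} {T : finType} (q : T -> R) : Prop :=
  (forall t, 0 <= q t) /\ \sum_t q t = 1.

(* An empirical model assigns to each j : 'Z_5 a joint distribution
   e j b b' of the outcomes b, b' in the context {j, j + 1}. *)
Definition noncontextual {R : realType} (e : 'Z_5 -> bool -> bool -> R[i]) :
    Prop :=
  exists (L : finType) (q : L -> R) (p : 'Z_5 -> L -> bool -> R),
    [/\ is_distr q,
        forall j l, is_distr (p j l)
      & forall j b b',
          e j b b' = (\sum_l q l * p j l b * p (j + 1) l b')%:C].

Definition psi {R : realType} (c0 c1 : R) : 'cV[R[i]]_(2 * 3) :=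
  c0%:C *: (ket (0 : 'I_2) *t ket (0 : 'I_3))
  + c1%:C *: (ket (1 : 'I_2) *t ket (1 : 'I_3)).

Definition sigma_z {R : realType} : 'M[R[i]]_2 := ketbra (ket 0) - ketbra (ket 1).

Definition kcbs_vec {R : realType} (theta : R) (j : 'Z_5) : 'cV[R[i]]_3 :=
  let phi : R := 4 * pi * (nat_of_ord j)%:R / 5 in
  (cos theta)%:C *: ket 0
  + (sin theta * cos phi)%:C *: ket 1
  + (sin theta * sin phi)%:C *: ket 2.

Definition kcbs_P {R : realType} (theta : R) (j : 'Z_5) : 'M[R[i]]_3 :=
  ketbra (kcbs_vec theta j).

Definition kcbs_B {R : realType} (theta : R) (j : 'Z_5) : 'M[R[i]]_3 :=
  1%:M - 2 *: kcbs_P theta j.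

Definition kcbs_D {R : realType} (theta : R) : 'M[R[i]]_3 :=
  \sum_(j : 'Z_5) kcbs_B theta j *m kcbs_B theta (j + 1).

Definition kcbs_model {R : realType} (theta : R) (rho : 'M[R[i]]_3)
    (j : 'Z_5) : bool -> bool -> R[i] :=
  joint_prob rho (kcbs_B theta j) (kcbs_B theta (j + 1)).

Definition a_KCBS {R : realType} : R := 1 / 2 + Num.sqrt 5 / 10.

(* Main.v *)
Require Import Defs.
From mathcomp Require Import all_boot all_order all_algebra.
From mathcomp Require Import complex mxtens.
From mathcomp Require Import reals trigo.
From mathcomp Require Import ring lra.
Import Order.TTheory GRing.Theory Num.Theory.
Local Open Scope ring_scope.
Local Open Scope complex_scope.

(* Since cos(4 pi / 5) = -(1 + sqrt 5) / 4, consecutive vectors v_j, v_(j+1)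
   are orthogonal, so D = 5 - 4 \sum_j P_j, and the model in a state rho is
   determined by the weights w_j = tr (rho P_j): the outcomes of B_j and
   B_(j+1) are never both -1.  Such a model is noncontextual as soon as w is a
   convex combination of indicators of stable sets of the 5-cycle.  Here w is
   invariant under j -> -j, with w_1 >= w_2, so the only conditions that matter
   are w_0 + w_1 <= 1 and \sum_j w_j <= 2; the latter is a <= a_KCBS.
   Conditioning on A_1 = +1 projects Bob onto |0>, where every w_j is
   1 / sqrt 5, which gives 5 - 4 sqrt 5. *)

(** * Traces, partial traces and expectations on tensor products *)

Lemma mxtrace_tens (R : comPzRingType) m n (A : 'M[R]_m) (B : 'M[R]_n) :
  \tr (A *t B) = \tr A * \tr B.
Proof.
rewrite /mxtrace mulr_sum; apply: eq_bigr => k _.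
by case: (mxtens_indexP k) => i j; rewrite mxE.
Qed.

Lemma ptrace1_tens (R : realType) m n (A : 'M[R[i]]_m) (B : 'M[R[i]]_n) :
  ptrace1 (A *t B) = \tr A *: B.
Proof.
apply/matrixP=> i j; rewrite !mxE mulr_suml; apply: eq_bigr => k _.
by rewrite tensmxE.
Qed.

Lemma ptrace1D (R : realType) m n (X Y : 'M[R[i]]_(m * n)) :
  ptrace1 (X + Y) = ptrace1 X + ptrace1 Y.
Proof.
by apply/matrixP=> i j; rewrite !mxE -big_split; apply: eq_bigr => k _; rewrite mxE.
Qed.

Lemma ptrace1Z (R : realType) m n c (X : 'M[R[i]]_(m * n)) :
  ptrace1 (c *: X) = c *: ptrace1 X.
Proof.
by apply/matrixP=> i j; rewrite !mxE big_distrr; apply: eq_bigr => k _; rewrite mxE.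
Qed.

Lemma tr_delta_mul (R : comPzRingType) n (i j : 'I_n) (X : 'M[R]_n) :
  \tr (delta_mx i j *m X) = X j i.
Proof.
rewrite /mxtrace (bigD1 i) //= big1 ?addr0.
  rewrite mxE (bigD1 j) //= big1 ?addr0; first by rewrite mxE !eqxx mul1r.
  by move=> k /negPf kj; rewrite mxE kj andbF mul0r.
by move=> k /negPf ki; rewrite mxE big1 // => l _; rewrite mxE ki mul0r.
Qed.

Lemma expectDl (R : realType) n (rho sigma X : 'M[R[i]]_n) :
  expect (rho + sigma) X = expect rho X + expect sigma X.
Proof. by rewrite /expect mulmxDl mxtraceD. Qed.

Lemma expectZl (R : realType) n c (rho X : 'M[R[i]]_n) :
  expect (c *: rho) X = c * expect rho X.
Proof. by rewrite /expect -scalemxAl mxtraceZ. Qed.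

Lemma expect_delta_tens (R : realType) m n (i j : 'I_m) (k l : 'I_n)
    (X : 'M[R[i]]_m) (Y : 'M[R[i]]_n) :
  expect (delta_mx i j *t delta_mx k l) (X *t Y) = X j i * Y l k.
Proof. by rewrite /expect tensmx_mul mxtrace_tens !tr_delta_mul. Qed.

(** * The state [psi], its reduced state and its post-measurement state *)

Lemma ketbraE (R : realType) n (v : 'cV[R[i]]_n) i j :
  ketbra v i j = v i 0 * conjc (v j 0).
Proof. by rewrite /ketbra mxE big_ord1 !mxE. Qed.

Lemma ketbra_ket (R : realType) n (i : 'I_n) :
  ketbra (ket i) = delta_mx i i :> 'M[R[i]]_n.
Proof. by rewrite /ketbra /ket trmx_delta map_delta_mx mul_delta_mx. Qed.

(** The cross terms are kept: they die for a different reason in each use, namely a zero trace, a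
    projection, or a diagonal observable. *)
Lemma ketbra_ket_tens (R : realType) m n (i0 i1 : 'I_m) (j0 j1 : 'I_n) (c0 c1 : R) :
  ketbra (c0%:C *: (ket i0 *t ket j0) + c1%:C *: (ket i1 *t ket j1)) =
    (c0 ^+ 2)%:C *: (delta_mx i0 i0 *t delta_mx j0 j0)
    + (c0 * c1)%:C *: (delta_mx i0 i1 *t delta_mx j0 j1)
    + (c1 * c0)%:C *: (delta_mx i1 i0 *t delta_mx j1 j0)
    + (c1 ^+ 2)%:C *: (delta_mx i1 i1 *t delta_mx j1 j1).
Proof.
pose x (k : 'I_m) (l : 'I_n) := ket k *t ket l : 'M[R[i]]_(_, _).
have outer k k' l l' : x k k' *m map_mx (@conjc R) (x l l')^T
    = delta_mx k l *t delta_mx k' l'.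
  rewrite /x trmx_tens !trmx_delta map_mxT !map_delta_mx.
  by rewrite tensmx_mul !mul_delta_mx.
rewrite -!outer /ketbra -!/(x _ _).
move: (x i0 j0) (x i1 j1) => u v.
apply/matrixP=> i j; rewrite !mxE !big_ord1 !mxE.
rewrite [Num.conj _](_ : _ = c0%:C * conjc (u j 0) + c1%:C * conjc (v j 0)).
  by rewrite !rmorphM; ring.
have conjcE (a b : R[i]) : conjc (c0%:C * a + c1%:C * b)
    = c0%:C * conjc a + c1%:C * conjc b.
  by rewrite rmorphD /= !rmorphM /= oppr0.
exact: conjcE.
Qed.

Lemma ptrace1_psi (R : realType) (c0 c1 : R) :
  ptrace1 (ketbra (psi c0 c1))
    = (c0 ^+ 2)%:C *: delta_mx 0 0 + (c1 ^+ 2)%:C *: delta_mx 1 1.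
Proof.
have tr_delta i j : \tr (delta_mx i j : 'M[R[i]]_2) = (i == j)%:R.
  by rewrite -[delta_mx i j]mulmx1 tr_delta_mul mxE eq_sym.
rewrite /psi ketbra_ket_tens !ptrace1D !ptrace1Z !ptrace1_tens !tr_delta /=.
by rewrite !scale0r !scaler0 !scale1r !addr0.
Qed.

Lemma outcome_proj_sigma_z (R : realType) :
  outcome_proj sigma_z false = delta_mx 0 0 :> 'M[R[i]]_2.
Proof.
rewrite /outcome_proj /sigma_z !ketbra_ket [outcome _]expr0 scale1r.
apply/matrixP=> i j; rewrite !mxE.
case: i => [[|[|[]]]] //= Hi; case: j => [[|[|[]]]] //= Hj.
all: rewrite ?(subr0, sub0r, addr0, mulr0, subrr) //.
by apply: mulVf; rewrite pnatr_eq0.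
Qed.

(** Projecting Alice onto |0> on both sides leaves only the first of the four terms. Its weight c0^2
    is the outcome probability, which the normalization cancels. *)
Lemma post_state_psi (R : realType) (c0 c1 : R) :
  c0 != 0 -> post_state (ketbra (psi c0 c1)) sigma_z false = delta_mx 0 0.
Proof.
move=> c0N0; rewrite /post_state outcome_proj_sigma_z ketbra_ket_tens.
set E := delta_mx 0 0 *t 1%:M.
have project i j (Y : 'M_3) : E *m (delta_mx i j *t Y) *m E
    = (((i == 0) && (j == 0))%:R : R[i]) *: (delta_mx 0 0 *t Y).
  rewrite !tensmx_mul mul1mx mulmx1; case: eqVneq => [->|i0] /=; last first.
    by rewrite mul_delta_mx_0 1?eq_sym // mul0mx tens0mx scale0r.
  rewrite mul_delta_mx; case: eqVneq => [->|j0] /=; last first.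
    by rewrite mul_delta_mx_0 // tens0mx scale0r.
  by rewrite mul_delta_mx scale1r.
have expand N (F X1 X2 X3 X4 : 'M[R[i]]_N) a1 a2 a3 a4 :
    F *m (a1 *: X1 + a2 *: X2 + a3 *: X3 + a4 *: X4) *m F
    = a1 *: (F *m X1 *m F) + a2 *: (F *m X2 *m F) + a3 *: (F *m X3 *m F)
      + a4 *: (F *m X4 *m F).
  by rewrite !mulmxDr !mulmxDl -!scalemxAr -!scalemxAl.
rewrite expand (project 0 0) (project 0 1) (project 1 0) (project 1 1) /=.
rewrite !scale0r !scaler0 !addr0 scale1r.
rewrite ptrace1Z ptrace1_tens mxtraceZ mxtrace_tens.
have tr0 n : \tr (delta_mx 0 0 : 'M[R[i]]_n.+1) = 1.
  rewrite /mxtrace (bigD1 0) //= big1 ?addr0 ?mxE //.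
  by move=> k /negPf k0; rewrite mxE k0.
rewrite !tr0 mulr1 mulr1 scale1r scalerA mulVf ?scale1r //.
by rewrite (inj_eq (@complexI R) _ 0) expf_neq0.
Qed.

(** The cross terms of the state pair with the off-diagonal entries of [X]. Both observables of W
    are diagonal on Alice's side. *)
Lemma expect_psi_tens (R : realType) (c0 c1 : R) (X : 'M[R[i]]_2) (Y : 'M[R[i]]_3) :
  X 0 1 = 0 -> X 1 0 = 0 ->
  expect (ketbra (psi c0 c1)) (X *t Y)
    = (c0 ^+ 2)%:C * (X 0 0 * Y 0 0) + (c1 ^+ 2)%:C * (X 1 1 * Y 1 1).
Proof.
move=> X01 X10; rewrite ketbra_ket_tens !expectDl !expectZl !expect_delta_tens.
by rewrite X01 X10 !(mul0r, mulr0) !addr0.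
Qed.

(** * Joint measurement of reflections, and noncontextual models on the 5-cycle *)

Lemma mulmx_reflections (R : comNzRingType) n (P Q : 'M[R]_n) :
  P *m Q = 0 ->
  (1%:M - 2 *: P) *m (1%:M - 2 *: Q) = 1%:M - 2 *: (P + Q).
Proof.
move=> PQ0; rewrite mulmxBl mul1mx mulmxBr mulmx1 -scalemxAl -scalemxAr PQ0 !scaler0.
by rewrite subr0 scalerDr opprD addrA addrAC.
Qed.

Lemma outcome_proj_reflection (R : realType) n (P : 'M[R[i]]_n) b :
  outcome_proj (1%:M - 2 *: P) b = if b then P else 1%:M - P.
Proof.
have halfK X : 2^-1 *: (2 *: X) = X :> 'M[R[i]]_n.
  by rewrite scalerA mulVf ?pnatr_eq0 // scale1r.
rewrite /outcome_proj /outcome; case: b; rewrite ?expr1 ?expr0.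
  by rewrite scaleN1r opprB addrC subrK halfK.
rewrite scale1r addrA -[RHS]halfK; congr (_ *: _).
by rewrite scalerBr [2 *: 1%:M]scaler_nat mulr2n.
Qed.

(** Joint law of two events that never occur together, with marginal probabilities [p] and [p'];
    [true], the value -1, stands for occurrence. *)
Definition exclusive_prob {R : realType} (p p' : R) (b b' : bool) : R :=
  match b, b' with
  | true, true => 0
  | true, false => p
  | false, true => p'
  | false, false => 1 - p - p'
  end.

Lemma joint_prob_reflections (R : realType) n (P Q rho : 'M[R[i]]_n) (p q : R) b b' :
  P *m Q = 0 -> \tr rho = 1 -> expect rho P = p%:C -> expect rho Q = q%:C ->
  joint_prob rho (1%:M - 2 *: P) (1%:M - 2 *: Q) b b' = (exclusive_prob p q b b')%:C.
Proof.
rewrite /expect => PQ0 tr1 rhoP rhoQ.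
rewrite /joint_prob !outcome_proj_reflection /expect.
case: b; case: b'; rewrite ?PQ0 ?mulmx0 ?mxtrace0 //=.
- by rewrite mulmxBr mulmx1 PQ0 subr0.
- by rewrite mulmxBl mul1mx PQ0 subr0.
rewrite mulmxBl mul1mx [P *m _]mulmxBr mulmx1 PQ0 subr0.
by rewrite !mulmxBr mulmx1 !linearB /= tr1 rhoP rhoQ addrAC -!rmorphB.
Qed.

(* The hidden variable l assigns the outcome true (i.e. -1) exactly to the
   vertices of the stable set S l of the 5-cycle. *)
Lemma noncontextual_stable (R : realType) (e : 'Z_5 -> bool -> bool -> R[i])
    (w : 'Z_5 -> R) (L : finType) (q : L -> R) (S : L -> pred 'Z_5) :
  is_distr q ->
  (forall l j, ~~ (S l j && S l (j + 1))) ->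
  (forall j, \sum_(l | S l j) q l = w j) ->
  (forall j b b', e j b b' = (exclusive_prob (w j) (w (j + 1)) b b')%:C) ->
  noncontextual e.
Proof.
move=> [q_ge0 q1] stableS wE eE.
exists L, q, (fun j l b => (b == S l j)%:R); split=> //.
  move=> j l; split=> [b|]; first exact: ler0n.
  by rewrite big_bool; case: (S l j); rewrite /= (addr0, add0r).
move=> j b b'; rewrite eE; congr _%:C.
have S0 l : S l j -> S l (j + 1) = false.
  by move=> Sj; apply/negbTE; have := stableS l j; rewrite Sj.
rewrite /exclusive_prob -!wE !(big_mkcond (fun l => S l _)).
case: b; case: b'.
- rewrite big1 // => l _.
  by case: (boolP (S l j)) => [/S0 ->|_]; rewrite !(mulr0, mul0r).
(* When both outcomes are [false], the constant 1 is written as the total mass of [q], so that all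
   remaining cases can be compared term by term. *)
3: rewrite -[X in X - _ - _]q1 -!sumrB.
all: apply: eq_bigr => l _; case: (boolP (S l j)) => [/S0 ->|_].
all: by try case: (S l (j + 1)); rewrite /= ?(mulr1, mulr0, subr0, subrr, mul0r).
Qed.

(** All five stable pairs of the 5-cycle, with {0} and the empty set. The reflection j -> -j swaps
    {0,2} with {0,3} and {1,3} with {2,4}, and fixes the others. *)
Definition pentagon_stable : seq (seq nat) :=
  [:: [:: 1; 4]; [:: 0; 2]; [:: 0; 3]; [:: 1; 3]; [:: 2; 4]; [:: 0]; [::]]%N.

(** The last inequality is half of the KCBS condition \sum_j w_j <= 2, and [al + be <= 1] is the
    condition on the edge {0,1}. *)
Lemma noncontextual_pentagon (R : realType) (e : 'Z_5 -> bool -> bool -> R[i])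
    (w : 'Z_5 -> R) (al be ga : R) :
  0 <= al -> 0 <= ga <= be -> al + be <= 1 -> al / 2 + be + ga <= 1 ->
  (forall j, w j = [:: al; be; ga; ga; be]`_j) ->
  (forall j b b', e j b b' = (exclusive_prob (w j) (w (j + 1)) b b')%:C) ->
  noncontextual e.
Proof.
move=> al0 /andP[ga0 gabe] albe half wE.
have [v [v0 v_al v_ga v_tot]] : exists v,
    [/\ 0 <= v, v <= al / 2, v <= ga & al + be + ga - v <= 1].
  (* The bound on the total is [al / 2 + be + ga <= 1] when v = al / 2, and [al + be <= 1] when v =
     ga. *)
  by case: (leP (al / 2) ga) => h; [exists (al / 2)|exists ga]; split; lra.
(* Once {0,2} and {0,3} get weight v, the marginals al, be, ga force the other
   weights; v = min(al / 2, ga) makes them all nonnegative. *)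
pose q (l : 'I_7) :=
  [:: be - ga + v; v; v; ga - v; ga - v; al - 2 * v; 1 - (al + be + ga - v)]`_l.
pose S (l : 'I_7) := [pred j : 'Z_5 | nat_of_ord j \in nth [::] pentagon_stable l].
apply: (@noncontextual_stable _ _ w _ q S).
- split; first by case=> [[|[|[|[|[|[|[|]]]]]]]] //= Hl; rewrite /q /=; lra.
  by rewrite !big_ord_recl big_ord0 /q /=; ring.
- by case=> [[|[|[|[|[|[|[|l]]]]]]] Hl]; case=> [[|[|[|[|[|j]]]]] Hj].
move=> j; rewrite big_mkcond !big_ord_recl big_ord0 wE /q.
by case: j => [[|[|[|[|[|]]]]] Hj] //=; ring.
Qed.

(** * Angles of the KCBS vectors *)

Lemma cos_4pi5 (R : realType) : cos (4 * pi / 5) = - (1 + Num.sqrt 5) / 4 :> R.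
Proof.
set y : R := 4 * pi / 5; set x := cos y.
(* The sign rules out the other roots 1 and (sqrt 5 - 1) / 4 of the cubic below. It comes from 2 pi
   - 4 pi / 5 = pi / 5 + pi. *)
have x_lt0 : x < 0.
  have -> : x = - cos (pi / 5).
    rewrite -(cosDpi (pi / 5)) /x -[LHS]cosN -[LHS]cosD2pi.
    by congr cos; rewrite /y; field.
  by rewrite oppr_lt0; apply: cos_gt0_pihalf; have := @pi_gt0 R; lra.
have r_gt1 : 1 < Num.sqrt 5 :> R by rewrite -[ltLHS]sqrtr1 ltr_sqrt ?(ltr1n, ltr0n).
have r2 : Num.sqrt 5 ^+ 2 = 5 :> R by rewrite sqr_sqrtr.
have c2 : cos (y *+ 2) = 2 * x ^+ 2 - 1 by rewrite cos_mulr2n -/x; ring.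
(* 5 y = 4 pi, hence cos (3 y) = cos (2 y). *)
have : (x - 1) * (4 * x ^+ 2 + 2 * x - 1) = 0.
  have : cos (y *+ 2 + y) = cos (y *+ 2).
    rewrite -[RHS]cosN -[RHS](periodicn (@cosD2pi R) 2); congr cos.
    by rewrite /y; field.
  rewrite cosD c2 sin_mulr2n -/x.
  have := sin2cos2 y; rewrite -/x; set s := sin y => s2.
  have -> : (x * s) *+ 2 * s = 2 * x * (1 - x ^+ 2) by rewrite -s2; ring.
  by move/eqP; rewrite -subr_eq0 => /eqP <-; ring.
move/eqP; rewrite mulf_eq0 => /orP[/eqP|/eqP] h; first by nra.
have /eqP : (4 * x + 1 - Num.sqrt 5) * (4 * x + 1 + Num.sqrt 5) = 0.
  have -> : (4 * x + 1 - Num.sqrt 5) * (4 * x + 1 + Num.sqrt 5)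
    = 4 * (4 * x ^+ 2 + 2 * x - 1) + (5 - Num.sqrt 5 ^+ 2) by ring.
  by rewrite h r2; ring.
rewrite mulf_eq0 => /orP[/eqP|/eqP] h'; lra.
Qed.

(** Convertible to the local angle [phi] of [kcbs_vec]. *)
Definition kcbs_angle {R : realType} (j : 'Z_5) : R :=
  4 * pi * (nat_of_ord j)%:R / 5.

Lemma cos_kcbs_angle (R : realType) (j : 'Z_5) :
  cos (kcbs_angle j)
    = [:: 1; - (1 + Num.sqrt 5) / 4; (Num.sqrt 5 - 1) / 4;
          (Num.sqrt 5 - 1) / 4; - (1 + Num.sqrt 5) / 4]`_j :> R.
Proof.
have c2 : cos (8 * pi / 5) = (Num.sqrt 5 - 1) / 4 :> R.
  have -> : 8 * pi / 5 = (4 * pi / 5) *+ 2 :> R by field.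
  have r2 : Num.sqrt 5 ^+ 2 = 5 :> R by rewrite sqr_sqrtr ?ler0n.
  by rewrite cos_mulr2n cos_4pi5; field: r2.
(* The angles of j and 5 - j add up to 4 pi, which reduces j = 3, 4 to j = 2, 1. *)
have reflect k : cos (pi *+ 2 *+ 2 - k) = cos k :> R.
  by rewrite addrC periodicn ?cosN //; apply: cosD2pi.
rewrite /kcbs_angle; case: j => [[|[|[|[|[|j]]]]] Hj] //=.
- by rewrite -[RHS]cos0; congr cos; field.
- by rewrite -[RHS]cos_4pi5; congr cos; field.
- by rewrite -c2; congr cos; field.
- by rewrite -c2 -reflect; congr cos; field.
- by rewrite -cos_4pi5 -reflect; congr cos; field.
Qed.

Lemma cos_kcbs_angleB (R : realType) (j : 'Z_5) :
  cos (kcbs_angle j - kcbs_angle (j + 1)) = - (1 + Num.sqrt 5) / 4 :> R.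
Proof.
have jS : nat_of_ord (j + 1) = nth 0 [:: 1; 2; 3; 4; 0]%N j.
  by case: j => [[|[|[|[|[|j]]]]] Hj].
rewrite -cos_4pi5 /kcbs_angle jS; case: j {jS} => [[|[|[|[|[|j]]]]] Hj] //=.
(* At j = 4 the successor wraps around to 0, so the difference is 16 pi / 5 = 4 pi - 4 pi / 5
   instead of -4 pi / 5. *)
5: rewrite -[RHS]cosN -[RHS](periodicn (@cosD2pi R) 2) -[LHS]cosN.
all: by rewrite -[LHS]cosN; congr cos; field.
Qed.

Lemma kcbs_vecE (R : realType) (theta : R) j (i : 'I_3) :
  kcbs_vec theta j i 0
    = ([:: cos theta; sin theta * cos (kcbs_angle j);
           sin theta * sin (kcbs_angle j)]`_i)%:C.
Proof.
rewrite /kcbs_vec /ket !mxE /=; case: i => [[|[|[|i]]] Hi] //=;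
  by rewrite ?(mulr1, mulr0, addr0, add0r).
Qed.

(** * The KCBS projections, the operator D and Bob's weights *)

Lemma sum_edges_Z5 (V : nmodType) (f : 'Z_5 -> V) :
  \sum_(j : 'Z_5) (f j + f (j + 1)) = (\sum_(j : 'Z_5) f j) *+ 2.
Proof.
rewrite big_split mulr2n; congr (_ + _).
by rewrite [RHS](reindex_inj (@addIr 'Z_5 1)).
Qed.

(** The squared |1>-component of v_j, sin^2 theta cos^2 (4 pi j / 5), evaluated at cos^2 theta = 1 /
    sqrt 5. *)
Definition kcbs_vec1_sqr {R : realType} (j : 'Z_5) : R :=
  [:: 1 - Num.sqrt 5 / 5; 1 / 4 + Num.sqrt 5 / 20; 1 / 2 - Num.sqrt 5 / 5;
      1 / 2 - Num.sqrt 5 / 5; 1 / 4 + Num.sqrt 5 / 20]`_j.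

(** The probability tr (rho_B P_j) of the value -1 for B_j, where rho_B = diag (a, 1 - a, 0). *)
Definition kcbs_weight {R : realType} (a : R) (j : 'Z_5) : R :=
  a * (Num.sqrt 5 / 5) + (1 - a) * kcbs_vec1_sqr j.

Section Kcbs.
Variables (R : realType) (theta : R).
Hypothesis cos_sqr : cos theta ^+ 2 = 1 / Num.sqrt 5.

Lemma cos_theta_sqr : cos theta ^+ 2 = Num.sqrt 5 / 5.
Proof.
have r0 : Num.sqrt 5 != 0 :> R by rewrite sqrtr_eq0 -ltNge ltr0n.
rewrite cos_sqr div1r.
apply: (mulfI r0); rewrite mulfV // mulrA -expr2 sqr_sqrtr ?ler0n // divff //.
by rewrite pnatr_eq0.
Qed.

(** The inner product of neighbours is cos^2 theta + sin^2 theta cos (4 pi / 5), and cos^2 theta = 1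
    / sqrt 5 is the value at which it vanishes. *)
Lemma kcbs_P_orthogonal j : kcbs_P theta j *m kcbs_P theta (j + 1) = 0.
Proof.
have innerE (u v : 'cV[R[i]]_3) :
    map_mx (@conjc R) u^T *m v = (\sum_k conjc (u k 0) * v k 0)%:M.
  apply/matrixP=> k l; rewrite !ord1 !mxE mulr1n.
  by apply: eq_bigr => i _; rewrite !mxE.
have orth : map_mx (@conjc R) (kcbs_vec theta j)^T *m kcbs_vec theta (j + 1) = 0.
  rewrite innerE (_ : \sum_k _ = 0) ?raddf0 //.
  under eq_bigr => k _ do rewrite kcbs_vecE conjc_real kcbs_vecE -rmorphM.
  rewrite !big_ord_recl big_ord0 addr0 -!rmorphD /=.
  rewrite -(rmorph0 (real_complex R)); congr _%:C.
  have := cos_kcbs_angleB R j; rewrite cosB => cosE.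
  transitivity (cos theta ^+ 2 + sin theta ^+ 2 *
    (cos (kcbs_angle j) * cos (kcbs_angle (j + 1))
     + sin (kcbs_angle j) * sin (kcbs_angle (j + 1)))); first by ring.
  rewrite cosE sin2cos2 cos_theta_sqr.
  have r2 : Num.sqrt 5 ^+ 2 = 5 :> R by rewrite sqr_sqrtr ?ler0n.
  by field: r2.
by rewrite /kcbs_P /ketbra mulmxA -[_ *m _ *m kcbs_vec _ _]mulmxA orth mulmx0 mul0mx.
Qed.

(** Each context contributes 1 - 2 (P_j + P_(j+1)), and each vertex lies on two edges, whence the
    coefficient 4. *)
Lemma kcbs_DE : kcbs_D theta = 5 *: 1%:M - 4 *: \sum_j kcbs_P theta j.
Proof.
rewrite /kcbs_D.
under eq_bigr => j _ do rewrite mulmx_reflections ?kcbs_P_orthogonal //.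
rewrite sumrB sumr_const card_ord -scaler_sumr.
rewrite [X in _ *: X](sum_edges_Z5 _ (kcbs_P theta)).
by rewrite !scaler_nat -mulrnA.
Qed.

Lemma kcbs_P00 j : kcbs_P theta j 0 0 = (Num.sqrt 5 / 5)%:C.
Proof.
by rewrite /kcbs_P ketbraE kcbs_vecE conjc_real -rmorphM -expr2 cos_theta_sqr.
Qed.

Lemma kcbs_P11 j :
  kcbs_P theta j 1 1 = (kcbs_vec1_sqr j)%:C.
Proof.
rewrite /kcbs_P ketbraE kcbs_vecE conjc_real -rmorphM -expr2; congr _%:C.
rewrite /= exprMn sin2cos2 cos_theta_sqr cos_kcbs_angle.
have r2 : Num.sqrt 5 ^+ 2 = 5 :> R by rewrite sqr_sqrtr ?ler0n.
by rewrite /kcbs_vec1_sqr; case: j => [[|[|[|[|[|j]]]]] Hj] //=; field: r2.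
Qed.

Lemma kcbs_D_diag i (p : 'Z_5 -> R) :
  (forall j, kcbs_P theta j i i = (p j)%:C) ->
  kcbs_D theta i i = (5 - 4 * \sum_(j : 'Z_5) p j)%:C.
Proof.
move=> Pii; rewrite kcbs_DE.
have -> : \sum_(j : 'Z_5) p j = \sum_(j < 5) p j by [].
have entry (S : 'M[R[i]]_3) : (5 *: 1%:M - 4 *: S) i i = 5 - 4 * S i i.
  by rewrite !mxE eqxx mulr1.
rewrite entry summxE (eq_bigr _ (fun j _ => Pii j)).
by rewrite !(rmorphB, rmorphM, rmorph_sum, rmorph_nat).
Qed.

Lemma kcbs_D00 : kcbs_D theta 0 0 = (5 - 4 * Num.sqrt 5)%:C.
Proof.
rewrite (kcbs_D_diag _ _ kcbs_P00); congr _%:C.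
by rewrite !big_ord_recl big_ord0; field.
Qed.

Lemma kcbs_D11 : kcbs_D theta 1 1 = (2 * Num.sqrt 5 - 5)%:C.
Proof.
rewrite (kcbs_D_diag _ _ kcbs_P11); congr _%:C.
by rewrite /kcbs_vec1_sqr !big_ord_recl big_ord0 /=; field.
Qed.

Lemma expect_kcbs_P (a : R) j :
  expect (a%:C *: delta_mx 0 0 + (1 - a)%:C *: delta_mx 1 1) (kcbs_P theta j)
    = (kcbs_weight a j)%:C.
Proof.
rewrite expectDl !expectZl /expect !tr_delta_mul kcbs_P00 kcbs_P11.
by rewrite -!rmorphM -rmorphD.
Qed.

Lemma kcbs_modelE (a : R) j b b' :
  kcbs_model theta (a%:C *: delta_mx 0 0 + (1 - a)%:C *: delta_mx 1 1) j b b'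
    = (exclusive_prob (kcbs_weight a j) (kcbs_weight a (j + 1)) b b')%:C.
Proof.
apply: joint_prob_reflections (expect_kcbs_P a j) (expect_kcbs_P a (j + 1)).
  exact: kcbs_P_orthogonal.
rewrite mxtraceD !mxtraceZ -[delta_mx 0 0]mulmx1 -[delta_mx 1 1]mulmx1.
by rewrite !tr_delta_mul !mxE !mulr1 -rmorphD addrC subrK.
Qed.

(** With r = sqrt 5, the KCBS condition of [noncontextual_pentagon] reads a r / 2 + (1 - a) (5 - r)
    / 4 <= 1, that is a <= (r - 1) / (3 r - 5) = 1 / 2 + r / 10. *)
Lemma kcbs_noncontextual (a : R) :
  0 <= a <= a_KCBS ->
  noncontextual (kcbs_model theta
    (a%:C *: delta_mx 0 0 + (1 - a)%:C *: delta_mx 1 1)).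
Proof.
move=> /andP[a0 aK].
set r : R := Num.sqrt 5; have r2 : r ^+ 2 = 5 by rewrite sqr_sqrtr ?ler0n.
have r0 : 0 <= r by exact: sqrtr_ge0.
(* Rational bounds on sqrt 5; multiplied by a, they control the products a r that occur in the
   weights. *)
have r_lb : 11 / 5 <= r by nra.
have r_ub : r <= 9 / 4 by nra.
have aKr : a <= 1 / 2 + r / 10 by [].
have a1 : a <= 1 by lra.
have ar_lb : 11 / 5 * a <= a * r by rewrite mulrC ler_wpM2l.
have ar_ub : a * r <= 9 / 4 * a by rewrite [leRHS]mulrC ler_wpM2l.
(* As r^2 = 5, the right-hand side is (1 / 2 + r / 10) r. *)
have ar_K : a * r <= (r + 1) / 2.
  by apply: le_trans (ler_wpM2r r0 aKr) _; lra.
apply: (@noncontextual_pentagon _ _ (kcbs_weight a)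
  (a * (r / 5) + (1 - a) * (1 - r / 5)) (a * (r / 5) + (1 - a) * (1 / 4 + r / 20))
  (a * (r / 5) + (1 - a) * (1 / 2 - r / 5))); last exact: kcbs_modelE.
- nra.
- apply/andP; split; nra.
- nra.
- nra.
by case=> [[|[|[|[|[|j]]]]] Hj].
Qed.

End Kcbs.

(** * The KCBS values and noncontextuality for the state [psi] *)

Theorem mainTheorem3 (R : realType) (c0 c1 theta : R)
    (c0_ge0 : 0 <= c0) (c1_ge0 : 0 <= c1) (c_norm : c0 ^+ 2 + c1 ^+ 2 = 1)
    (cos_gt0 : 0 < cos theta) (sin_gt0 : 0 < sin theta)
    (cos_sqr : cos theta ^+ 2 = 1 / Num.sqrt 5) :
  let a : R := c0 ^+ 2 in
  let rho : 'M[R[i]]_(2 * 3) := ketbra (psi c0 c1) in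
  let rhoB : 'M[R[i]]_3 := ptrace1 rho in
  let rhoB_plus : 'M[R[i]]_3 := post_state rho sigma_z false in
  let D : 'M[R[i]]_3 := kcbs_D theta in
  let W : R[i] :=
    3 * expect rho (sigma_z *t (1%:M : 'M[R[i]]_3))
    + expect rho (((1%:M : 'M[R[i]]_2) + sigma_z) *t D) in
  [/\ rhoB = a%:C *: ketbra (ket 0) + (1 - a)%:C *: ketbra (ket 1),
      expect rhoB D
        = (a * (5 - 4 * Num.sqrt 5) + (1 - a) * (2 * Num.sqrt 5 - 5))%:C,
      (a <= a_KCBS -> noncontextual (kcbs_model theta rhoB))
        /\ (a_KCBS < a -> expect rhoB D < -3),
      0 < a -> expect rhoB_plus D = (5 - 4 * Num.sqrt 5)%:C
               /\ expect rhoB_plus D < -3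
    & [/\ W = (-3 - 8 * (Num.sqrt 5 - 2) * a)%:C,
          0 < a -> W < -3
        & 0 < a -> a <= a_KCBS ->
          noncontextual (kcbs_model theta rhoB) /\ expect rhoB_plus D < -3]].
Proof.
move=> a rho rhoB rhoB_plus D W.
have a_ge0 : 0 <= a by exact: sqr_ge0.
have rhoBE : rhoB = a%:C *: delta_mx 0 0 + (1 - a)%:C *: delta_mx 1 1.
  by rewrite /rhoB /rho ptrace1_psi -c_norm [X in (X - a)%:C]addrC addrK.
have D00 : D 0 0 = (5 - 4 * Num.sqrt 5)%:C by exact: kcbs_D00.
have D11 : D 1 1 = (2 * Num.sqrt 5 - 5)%:C by exact: kcbs_D11.
have BD : expect rhoB D
    = (a * (5 - 4 * Num.sqrt 5) + (1 - a) * (2 * Num.sqrt 5 - 5))%:C.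
  rewrite rhoBE expectDl !expectZl /expect !tr_delta_mul D00 D11.
  by rewrite -!rmorphM -rmorphD.
have r2 : Num.sqrt 5 ^+ 2 = 5 :> R by rewrite sqr_sqrtr ?ler0n.
have r0 : 0 <= Num.sqrt 5 :> R by exact: sqrtr_ge0.
have r_gt2 : 2 < Num.sqrt 5 :> R by nra.
have lt_m3 (x : R) : x < -3 -> (x%:C : R[i]) < -3.
  have -> : -3 = (-3 : R)%:C :> R[i] by rewrite rmorphN rmorph_nat.
  by rewrite ltcR.
have nonctx : a <= a_KCBS -> noncontextual (kcbs_model theta rhoB).
  by move=> aK; rewrite rhoBE; apply: kcbs_noncontextual => //; apply/andP.
have plusD : 0 < a -> expect rhoB_plus D = (5 - 4 * Num.sqrt 5)%:C.
  move=> a_gt0; rewrite /rhoB_plus /rho post_state_psi.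
    by rewrite /expect tr_delta_mul.
  by apply: contraTneq a_gt0 => c00; rewrite /a c00 expr0n ltxx.
have plus_lt : 0 < a -> expect rhoB_plus D < -3.
  by move=> a_gt0; rewrite plusD //; apply: lt_m3; lra.
have sz i j : sigma_z i j = (i == j)%:R * (-1) ^+ (i == 1) :> R[i].
  rewrite /sigma_z !ketbra_ket !mxE.
  by case: i => [[|[|i]] Hi] //; case: j => [[|[|j]] Hj] //=; rewrite ?mulr1n; ring.
(* Since 1 + sigma_z = diag (2, 0), only the entry [D 0 0] enters, and W = 3 (2 a - 1) + 2 a (5 - 4
   sqrt 5). *)
have WE : W = (-3 - 8 * (Num.sqrt 5 - 2) * a)%:C.
  have cE : c1 ^+ 2 = 1 - a by rewrite -c_norm [X in X - a]addrC addrK.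
  have addE (M : 'M[R[i]]_2) i j : (1%:M + M) i j = (i == j)%:R + M i j.
    by rewrite !mxE.
  have id3 i : (1%:M : 'M[R[i]]_3) i i = 1 by rewrite mxE eqxx.
  rewrite /W /rho (expect_psi_tens _ _ _ sigma_z) ?sz ?mul0r //.
  rewrite (expect_psi_tens _ _ _ (1%:M + sigma_z)) ?addE ?sz ?mul0r ?addr0 //.
  rewrite !id3 D00 D11 cE -/a /= expr0 expr1 !mulr1 mul1r subrr mul0r mulr0 addr0.
  have nE n : n%:R = n%:R%:C :> R[i] by rewrite rmorph_nat.
  rewrite mulrN1 mulrBr -[1 + 1]/(2%:R) !nE -!(rmorphM, rmorphB, rmorphD).
  by congr _%:C; ring.
split=> //.
- by rewrite rhoBE !ketbra_ket.
- split=> // a_gt; rewrite BD; apply: lt_m3.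
  (* The value 2 r - 5 - a (6 r - 10), with r = sqrt 5, decreases in a and equals -3 exactly at a =
     (r - 1) / (3 r - 5), which is [a_KCBS]. *)
  move: a_gt; rewrite /a_KCBS; nra.
- by move=> a_gt0; split; [exact: plusD|exact: plus_lt].
split; [exact: WE| |].
  by move=> a_gt0; rewrite WE; apply: lt_m3; nra.
by move=> a_gt0 aK; split; [exact: nonctx|exact: plus_lt].
Qed.
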